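(* Let $(V,m)$ be an $n$-ary Nambu algebra (resp. $n$-ary Nambu-Lie algebra, $n$-ary Lie algebra) and let $\rho: V\to V$ be an endomorphism of the $n$-ary Nambu (resp. $n$-ary Nambu-Lie, $n$-ary Lie) algebra $(V,m)$. Set $m_\rho=\rho\circ m$ and $\widetilde{\rho}=(\rho,\dots,\rho)$ ($n-1$ copies of $\rho$). Then $(V,m_\rho,\widetilde{\rho})$ is an $n$-ary Hom-Nambu algebra (resp. $n$-ary Hom-Nambu-Lie algebra, $n$-ary Hom-Lie algebra). Moreover, suppose that $(V',m')$ is another $n$-ary Nambu algebra (resp. $n$-ary Nambu-Lie algebra, $n$-ary Lie algebra) and $\rho': V'\to V'$ is an endomorphism of the $n$-ary Nambu (resp. $n$-ary Nambu-Lie, $n$-ary Lie) algebra $(V',m')$. If $f:V\to V'$ is a morphism of $n$-ary Nambu algebras (resp. $n$-ary Nambu-Lie algebras, $n$-ary Lie algebras) from $(V,m)$ to $(V',m')$ that satisfies $f\circ\rho=\rho'\circ f$, then $$f:(V,m_\rho,\widetilde{\rho})\longrightarrow (V',m'_{\rho'},\widetilde{\rho'})$$ is a morphism of $n$-ary Hom-Nambu algebras (resp. $n$-ary Hom-Nambu-Lie algebras, $n$-ary Hom-Lie algebras), where $m'_{\rho'}=\rho'\circ m'$ and $\widetilde{\rho'}=(\rho',\dots,\rho')$ ($n-1$ copies).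
   Context: Throughout, $\mathbb{K}$ is an algebraically closed field of characteristic zero, all vector spaces are over $\mathbb{K}$, and $n$ is a positive integer. $\mathcal{S}_k$ denotes the permutation group on $k$ elements and $Sgn$ the signature. An $n$-ary Hom-Nambu algebra is a triple $(V,[\cdot,\dots,\cdot],\alpha)$ consisting of a vector space $V$, an $n$-linear map $[\cdot,\dots,\cdot]:V^{\times n}\to V$ and a family $\alpha=(\alpha_i)_{i=1,\dots,n-1}$ of linear maps $\alpha_i:V\to V$ satisfying the $n$-ary Hom-Nambu identity $$[\alpha_1(x_1),\dots,\alpha_{n-1}(x_{n-1}),[x_n,\dots,x_{2n-1}]]=\sum_{i=n}^{2n-1}[\alpha_1(x_n),\dots,\alpha_{i-n}(x_{i-1}),[x_1,\dots,x_{n-1},x_i],\alpha_{i-n+1}(x_{i+1}),\dots,\alpha_{n-1}(x_{2n-1})]$$ for all $(x_1,\dots,x_{2n-1})\in V^{2n-1}$. An $n$-ary Hom-Nambu-Lie algebra is an $n$-ary Hom-Nambu algebra whose bracket is skew-symmetric, i.e. $[x_{\sigma(1)},\dots,x_{\sigma(n)}]=Sgn(\sigma)[x_1,\dots,x_n]$ for all $\sigma\in\mathcal{S}_n$ and all $x_1,\dots,x_n\in V$. An $n$-ary Hom-Lie algebra is a triple $(V,[\cdot,\dots,\cdot],\alpha)$ consisting of a vector space $V$, a skew-symmetric $n$-linear map $[\cdot,\dots,\cdot]:V^{\times n}\to V$ and a family $\alpha=(\alpha_i)_{i=1,\dots,n-1}$ of linear maps $\alpha_i:V\to V$ satisfying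 the $n$-ary Hom-Jacobi identity $$\sum_{\sigma\in\mathcal{S}_{2n-1}}Sgn(\sigma)[\alpha_1(x_{\sigma(1)}),\dots,\alpha_{n-1}(x_{\sigma(n-1)}),[x_{\sigma(n)},\dots,x_{\sigma(2n-1)}]]=0$$ for all $(x_1,\dots,x_{2n-1})\in V^{2n-1}$. The (classical) $n$-ary Nambu, $n$-ary Nambu-Lie and $n$-ary Lie algebras $(V,m)$ are, respectively, the $n$-ary Hom-Nambu, $n$-ary Hom-Nambu-Lie and $n$-ary Hom-Lie algebras $(V,m,\alpha)$ (with bracket $m$) in which all $\alpha_i$ are the identity map of $V$. A morphism $(V,m)\to(V',m')$ of such classical algebras is a linear map $f:V\to V'$ with $f(m(x_1,\dots,x_n))=m'(f(x_1),\dots,f(x_n))$ for all $x_1,\dots,x_n\in V$; an endomorphism is a morphism from $(V,m)$ to itself. A morphism of $n$-ary Hom-Nambu (resp. Hom-Nambu-Lie, Hom-Lie) algebras $(V,[\cdot,\dots,\cdot],\alpha)\to(V',[\cdot,\dots,\cdot]',\alpha')$ is a linear map $f:V\to V'$ such that $f([x_1,\dots,x_n])=[f(x_1),\dots,f(x_n)]'$ for all $x_1,\dots,x_n\in V$ and $f\circ\alpha_i=\alpha'_i\circ f$ for all $i=1,\dots,n-1$. *)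

(* Defs.v *)
From HB Require Import structures.
From mathcomp Require Import all_boot all_fingroup all_algebra.

Set Implicit Arguments.
Unset Strict Implicit.
Unset Printing Implicit Defensive.

Import GRing.Theory.
Local Open Scope ring_scope.

(* Families are indexed from 0: the argument x_(k+1) of an n-ary bracket is   *)
(* [x k] with [k : 'I_n], and alpha_(k+1) is [alpha k] with [k : 'I_n.-1].    *)
(* A (2n-1)-tuple is indexed by ['I_(n.-1 + n)], so that x_1, ..., x_(n-1)    *)
(* are reached through [lshift] and x_n, ..., x_(2n-1) through [rshift].      *)

Section Brackets.
Variables (K : closedFieldType) (n : nat).

Section OneSpace.
Variable V : lmodType K.
Implicit Types (m : {ffun 'I_n -> V} -> V) (alpha : 'I_n.-1 -> {linear V -> V}).

Definition nlinear m : Prop :=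
  forall (i : 'I_n) (x : {ffun 'I_n -> V}),
    linear (fun v => m [ffun j => if j == i then v else x j]).

Definition skew_symmetric m : Prop :=
  forall (s : 'S_n) (x : {ffun 'I_n -> V}),
    m [ffun i => x (s i)] = (-1) ^+ s *: m x.

(* (t_0, ..., t_(n-2), w) *)
Definition append (t : 'I_n.-1 -> V) (w : V) : {ffun 'I_n -> V} :=
  [ffun k : 'I_n => oapp t w (insub (k : nat))].

(* (t_0, ..., t_(i-1), w, t_i, ..., t_(n-2)), with w in position i *)
Definition insert (i : 'I_n) (t : 'I_n.-1 -> V) (w : V) : {ffun 'I_n -> V} :=
  [ffun k : 'I_n => oapp t w (unlift i k)].

(* The summand of index j below is the one of index i = n + j in              *)
(*   sum_(n <= i <= 2n-1) [alpha_1 x_n, ..., alpha_(i-n) x_(i-1),             *)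
(*      [x_1, ..., x_(n-1), x_i],                                             *)
(*      alpha_(i-n+1) x_(i+1), ..., alpha_(n-1) x_(2n-1)];                    *)
(* [lift j] enumerates the positions other than j in increasing order.        *)
Definition hom_nambu_identity m alpha : Prop :=
  forall x : {ffun 'I_(n.-1 + n) -> V},
    m (append (fun k => alpha k (x (lshift n k)))
              (m [ffun j => x (rshift n.-1 j)])) =
    \sum_(j < n)
      m (insert j (fun k => alpha k (x (rshift n.-1 (lift j k))))
                  (m (append (fun k => x (lshift n k)) (x (rshift n.-1 j))))).

Definition hom_jacobi_identity m alpha : Prop :=
  forall x : {ffun 'I_(n.-1 + n) -> V},
    \sum_(s : 'S_(n.-1 + n))
      (-1) ^+ s *: m (append (fun k => alpha k (x (s (lshift n k))))
                             (m [ffun j => x (s (rshift n.-1 j))])) = 0.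

Definition hom_nambu m alpha : Prop :=
  nlinear m /\ hom_nambu_identity m alpha.

Definition hom_nambu_lie m alpha : Prop :=
  hom_nambu m alpha /\ skew_symmetric m.

Definition hom_lie m alpha : Prop :=
  [/\ nlinear m, skew_symmetric m & hom_jacobi_identity m alpha].

Definition id_family : 'I_n.-1 -> {linear V -> V} := fun=> idfun.

End OneSpace.

Variant kind := Nambu | NambuLie | Lie.

Definition hom_algebra (c : kind) (V : lmodType K)
    (m : {ffun 'I_n -> V} -> V) (alpha : 'I_n.-1 -> {linear V -> V}) : Prop :=
  match c with
  | Nambu => hom_nambu m alpha
  | NambuLie => hom_nambu_lie m alpha
  | Lie => hom_lie m alpha
  end.

Definition classical_algebra (c : kind) (V : lmodType K)
    (m : {ffun 'I_n -> V} -> V) : Prop :=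
  hom_algebra c m (@id_family V).

(* Being a morphism does not depend on the kind of algebra; linearity is      *)
(* carried by the type of f.                                                  *)
Definition nary_morphism (V V' : lmodType K) (m : {ffun 'I_n -> V} -> V)
    (m' : {ffun 'I_n -> V'} -> V') (f : {linear V -> V'}) : Prop :=
  forall x : {ffun 'I_n -> V}, f (m x) = m' [ffun i => f (x i)].

Definition nary_endomorphism (V : lmodType K) (m : {ffun 'I_n -> V} -> V)
    (rho : {linear V -> V}) : Prop :=
  nary_morphism m m rho.

Definition hom_morphism (V V' : lmodType K)
    (m : {ffun 'I_n -> V} -> V) (alpha : 'I_n.-1 -> {linear V -> V})
    (m' : {ffun 'I_n -> V'} -> V') (alpha' : 'I_n.-1 -> {linear V' -> V'})
    (f : {linear V -> V'}) : Prop :=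
  nary_morphism m m' f /\ forall i : 'I_n.-1, f \o alpha i =1 alpha' i \o f.

End Brackets.

(* Main.v *)
Require Import Defs.
From HB Require Import structures.
From mathcomp Require Import all_boot all_fingroup all_algebra.
Import GRing.Theory.
Local Open Scope ring_scope.

(** Both the Hom-Nambu and the Hom-Jacobi identities are linear relations
    between twice nested brackets [t_1, ..., w, ..., t_(n-1)] with w a bracket.
    Twisting m into rho o m and every outer argument t_k into rho t_k turns each
    such nested bracket into its image under rho^2: one rho is there already in
    front of the outer bracket, and a second one factors out of it, because rho
    is an endomorphism and now stands in front of all n arguments, the inner
    bracket included ([twisted_append], [twisted_insert]). Hence the twisted
    identity is the image under the linear map rho^2 of the classical one.
    Multilinearity and skew-symmetry survive composition with any linear map,
    and the statement on morphisms only moves f across rho. *)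

Section YauTwist.
Set Implicit Arguments.
Unset Strict Implicit.
Variables (K : closedFieldType) (n : nat) (V : lmodType K).
Implicit Types (m : {ffun 'I_n -> V} -> V) (rho : {linear V -> V}).

Lemma ffun_append rho (t : 'I_n.-1 -> V) w :
  [ffun i => rho (append t w i)] = append (fun k => rho (t k)) (rho w).
Proof. by apply/ffunP => i; rewrite !ffunE; case: insub. Qed.

Lemma ffun_insert rho (j : 'I_n) (t : 'I_n.-1 -> V) w :
  [ffun i => rho (insert j t w i)] = insert j (fun k => rho (t k)) (rho w).
Proof. by apply/ffunP => i; rewrite !ffunE; case: unlift. Qed.

(** Used with w an untwisted inner bracket, so that rho w is the twisted one:
    of the two copies of rho on the right, one is the twist of the outer
    bracket and the other is pulled out of its arguments. *)
Lemma twisted_append m rho (t : 'I_n.-1 -> V) w :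
    nary_endomorphism m rho ->
  (rho \o m) (append (fun k => rho (t k)) (rho w)) = rho (rho (m (append t w))).
Proof. by move=> rhoE; rewrite /= -ffun_append -rhoE. Qed.

Lemma twisted_insert m rho (j : 'I_n) (t : 'I_n.-1 -> V) w :
    nary_endomorphism m rho ->
  (rho \o m) (insert j (fun k => rho (t k)) (rho w)) =
  rho (rho (m (insert j t w))).
Proof. by move=> rhoE; rewrite /= -ffun_insert -rhoE. Qed.

Lemma nlinear_comp m rho : nlinear m -> nlinear (rho \o m).
Proof. by move=> mL i x a u v; rewrite /= mL linearP. Qed.

Lemma skew_symmetric_comp m rho :
  skew_symmetric m -> skew_symmetric (rho \o m).
Proof. by move=> mS s x; rewrite /= mS linearZ. Qed.

Lemma hom_nambu_identity_twist m rho :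
    nary_endomorphism m rho -> hom_nambu_identity m (@id_family K n V) ->
  hom_nambu_identity (rho \o m) (fun=> rho).
Proof.
move=> rhoE mN x; rewrite (twisted_append _ _ rhoE).
under eq_bigr => j _ do rewrite (twisted_insert _ _ _ rhoE).
by rewrite -!linear_sum; congr (rho (rho _)); apply: mN.
Qed.

Lemma hom_jacobi_identity_twist m rho :
    nary_endomorphism m rho -> hom_jacobi_identity m (@id_family K n V) ->
  hom_jacobi_identity (rho \o m) (fun=> rho).
Proof.
move=> rhoE mJ x.
under eq_bigr => s _ do rewrite (twisted_append _ _ rhoE) -!linearZ.
rewrite -!linear_sum.
(* The simplification erases the identity maps of the classical family. *)
by have /= -> := mJ x; rewrite !linear0.
Qed.

Lemma hom_algebra_twist (c : kind) m rho :
    classical_algebra c m -> nary_endomorphism m rho ->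
  hom_algebra c (rho \o m) (fun=> rho).
Proof.
move=> Vm rhoE; case: c Vm => /=.
- by case=> mL mN; split;
    [exact: nlinear_comp | exact: hom_nambu_identity_twist].
- by case=> -[mL mN] mS; split; [split |];
    [exact: nlinear_comp | exact: hom_nambu_identity_twist
    | exact: skew_symmetric_comp].
- by case=> mL mS mJ; split;
    [exact: nlinear_comp | exact: skew_symmetric_comp
    | exact: hom_jacobi_identity_twist].
Qed.

Lemma hom_morphism_twist m rho (V' : lmodType K) (m' : {ffun 'I_n -> V'} -> V')
    (rho' : {linear V' -> V'}) (f : {linear V -> V'}) :
    nary_morphism m m' f -> f \o rho =1 rho' \o f ->
  hom_morphism (rho \o m) (fun=> rho) (rho' \o m') (fun=> rho') f.
Proof.
move=> fM frho; split=> // x.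
by rewrite /= -fM; apply: frho.
Qed.

End YauTwist.

Theorem theorem1p7 (K : closedFieldType) (charK : [pchar K] =i pred0)
    (n : nat) (n_gt0 : (0 < n)%N) (c : kind)
    (V : lmodType K) (m : {ffun 'I_n -> V} -> V) (rho : {linear V -> V})
    (Vm : classical_algebra c m) (rhoE : nary_endomorphism m rho) :
  hom_algebra c (rho \o m) (fun _ : 'I_n.-1 => rho) /\
  forall (V' : lmodType K) (m' : {ffun 'I_n -> V'} -> V')
      (rho' : {linear V' -> V'}) (f : {linear V -> V'}),
    classical_algebra c m' -> nary_endomorphism m' rho' ->
    nary_morphism m m' f -> f \o rho =1 rho' \o f ->
    hom_morphism (rho \o m) (fun _ : 'I_n.-1 => rho)
                 (rho' \o m') (fun _ : 'I_n.-1 => rho') f.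
Proof.
split; first exact: hom_algebra_twist.
by move=> V' m' rho' f _ _; apply: hom_morphism_twist.
Qed.
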